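(* Let $B$ be a finite set of positive integers with $|B|\ge2$, let $p$ be a prime, and let $n$ be a non-zero integer. Define \[X_p(B,n)=\{(b_1,b_2)\in B\times B:\ b_1-b_2=np^v\text{ for some }v\in\mathbb{Z}_{\ge0}\}.\] Then $|X_p(B,n)|\le 1+4|B|\log_2|B|$. *)

(* Defs.v *)
From mathcomp Require Import all_boot all_order all_algebra finmap.
From mathcomp Require Import all_classical all_reals all_analysis.
Set Implicit Arguments.
Unset Strict Implicit.
Unset Printing Implicit Defensive.
Import Order.TTheory GRing.Theory Num.Theory.
Local Open Scope fset_scope.
Local Open Scope ring_scope.

(* The difference b1 - b2 is taken in int: nat subtraction is truncated. *)
Definition Xp (p : nat) (B : {fset nat}) (n : int) : {fset nat * nat} :=
  [fset b in B `*` B |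
    `[< exists v : nat, b.1%:Z - b.2%:Z = n * p%:Z ^+ v >]].

Definition log2 (R : realType) (x : R) : R := ln x / ln 2.

(* Main.v *)
Require Import Defs.
From mathcomp Require Import all_boot all_order all_algebra finmap.
From mathcomp Require Import all_classical all_reals all_analysis.
From mathcomp Require Import lra.
Import Order.TTheory GRing.Theory Num.Theory.
Local Open Scope fset_scope.
Local Open Scope ring_scope.

(** Regard [Xp p B n] as the edge set of a directed graph on [B]. The graph
    can be cut with few edges lost. Take the least [m] such that [B] meets
    at least two classes modulo [n * p ^ m], and cut [B] along one of these
    classes. An edge [b1 - b2 = n * p ^ w] crossing the cut has [w < m],
    since otherwise both ends lie in the same class, and has [w >= m - 1],
    since otherwise [n * p ^ w.+1], which divides all differences in [B] by
    minimality of [m], would divide [n * p ^ w]. So all crossing edges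
    have the same difference ([exists_uniform_cut]), each vertex is on at most
    one as source and at most one as target, and a cut into parts of sizes
    [a] and [b] loses at most [2 * minn a b] edges ([leq_card_cut]).

    The function [2 N log2 N] grows at least as fast under this recursion: if
    [a <= b], passing from [a log2 a + b log2 b] to
    [(a + b) log2 (a + b)] gains at least [a], because [a + b >= 2 a]
    ([xlog2x_superadd]). By induction on the size of [B] the graph has at most
    [2 |B| log2 |B|] edges, which is stronger than the bound to be proved. *)

(** * Cutting the difference graph *)

Lemma XpP (p : nat) (B : {fset nat}) (n : int) (e : nat * nat) :
  reflect [/\ e.1 \in B, e.2 \in B &
             exists v : nat, e.1%:Z - e.2%:Z = n * p%:Z ^+ v]
          (e \in Xp p B n).
Proof.
rewrite !inE /=; apply: (iffP andP) => [[/andP[e1 e2] /asboolP ev]|[e1 e2 ev]].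
  by split.
by rewrite e1 e2; split=> //; apply/asboolP.
Qed.

Definition cut_edges (p : nat) (B : {fset nat}) (n : int) (A : {fset nat}) :
    {fset nat * nat} :=
  [fset e in Xp p B n | (e.1 \in A) != (e.2 \in A)].

Lemma in_cut_edges (p : nat) (B : {fset nat}) (n : int) (A : {fset nat})
    (e : nat * nat) :
  (e \in cut_edges p B n A) =
  (e \in Xp p B n) && ((e.1 \in A) != (e.2 \in A)).
Proof. by rewrite in_fset inE. Qed.

(** The classes modulo [n * p ^ m] refine as [m] grows and eventually separate
    any two integers; the cut is made where they first separate [B]. *)
Lemma exists_uniform_cut (p : nat) (B : {fset nat}) (n : int) :
  (1 < p)%N -> n != 0 -> (2 <= #|` B|)%N ->
  exists (A : {fset nat}) (d : int),
    [/\ A `<=` B, (0 < #|` A|)%N, (0 < #|` B `\` A|)%N &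
     forall e : nat * nat, e \in cut_edges p B n A -> e.1%:Z - e.2%:Z = d].
Proof.
move=> p1 n0 cB.
have [b0 b0B] : exists b0, b0 \in B by apply/fset0Pn; rewrite -cardfs_gt0 ltnW.
have [b1 /fsetD1P[b10 b1B]] : exists b1, b1 \in B `\ b0.
  by apply/fset0Pn; rewrite -cardfs_gt0; move: cB; rewrite (cardfsD1 b0) b0B.
pose same m x := (n * p%:Z ^+ m %| x%:Z - b0%:Z)%Z.
have pn0 m : n * p%:Z ^+ m != 0.
  by rewrite mulf_neq0 // expf_neq0 // eqz_nat -lt0n ltnW.
have sep : exists m, ~~ all (same m) (enum_fset B).
  (* a nonzero multiple of p ^ m has absolute value at least p ^ m > m *)
  exists `|b1%:Z - b0%:Z|%N; apply/allPn; exists b1 => //.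
  have nz : (0 < `|b1%:Z - b0%:Z|)%N by rewrite absz_gt0 subr_eq0 eqz_nat.
  apply/negP; rewrite /same dvdzE abszM => /(dvdn_leq nz).
  rewrite abszX absz_nat leqNgt => /negP; apply.
  by rewrite (leq_trans (ltn_expl _ p1)) // leq_pmull // absz_gt0.
case: (ex_minnP sep) => m /allPn[c cB' ncm] minm.
pose A := [fset x in B | same m x].
exists A, (n * p%:Z ^+ m.-1); split.
- by apply/fsubsetP => x; rewrite !inE => /andP[].
- rewrite cardfs_gt0; apply/fset0Pn; exists b0.
  by rewrite !inE /= b0B /same subrr dvdz0.
- rewrite cardfs_gt0; apply/fset0Pn; exists c.
  by rewrite !inE /= negb_and ncm orbT.
move=> [x y]; rewrite !inE /= => /andP[/andP[/andP[xB yB] /asboolP[w xy]]].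
rewrite xB yB /= xy => cross; congr (_ * _ ^+ _).
have wm : (w < m)%N.
  rewrite ltnNge; apply: contra cross => mw; apply/eqP; rewrite /same.
  have -> : x%:Z = y%:Z + n * p%:Z ^+ w by rewrite -xy addrC subrK.
  by rewrite addrAC rpredDr //; apply: dvdz_mul => //; exact: dvdz_exp2l.
apply/eqP; rewrite eqn_leq -ltnS (ltn_predK wm) wm /=.
rewrite leqNgt; apply/negP => w1.
have wm1 : (w.+1 < m)%N by rewrite -(ltn_predK wm) ltnS.
have sameB z : z \in B -> same w.+1 z.
  move=> zB; have : all (same w.+1) (enum_fset B).
    by apply/negPn/negP => /minm; rewrite leqNgt wm1.
  by move/allP; apply.
have : (n * p%:Z ^+ w.+1 %| n * p%:Z ^+ w)%Z.
  rewrite -xy.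
  have -> : x%:Z - y%:Z = (x%:Z - b0%:Z) - (y%:Z - b0%:Z).
    by rewrite opprB addrA subrK.
  by rewrite rpredB //; apply: sameB.
rewrite exprSr mulrA -[X in (_ %| X)%Z]mulr1 dvdz_mul2l //.
by rewrite dvdzE absz_nat dvdn1 => /eqP p1'; rewrite p1' in p1.
Qed.

(** An edge of prescribed difference is determined by either end, and a
    crossing edge has exactly one end in [S]. *)
Lemma leq_card_cut_edges (p : nat) (B S : {fset nat}) (n d : int) :
  (forall e : nat * nat, e \in cut_edges p B n S -> e.1%:Z - e.2%:Z = d) ->
  (#|` cut_edges p B n S| <= 2 * #|` S|)%N.
Proof.
move=> difE; set E := cut_edges p B n S in difE *.
pose E1 := [fset e in E | e.1 \in S]; pose E2 := [fset e in E | e.2 \in S].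
have in1 e : (e \in E1) = (e \in E) && (e.1 \in S) by rewrite in_fset inE.
have in2 e : (e \in E2) = (e \in E) && (e.2 \in S) by rewrite in_fset inE.
have sub : E `<=` E1 `|` E2.
  apply/fsubsetP => e eE; rewrite in_fsetU in1 in2 eE /=.
  move: eE; rewrite in_cut_edges => /andP[_].
  by case: (e.1 \in S); case: (e.2 \in S).
have c1 : (#|` E1| <= #|` S|)%N.
  have <- : #|` [fset e.1 | e in E1]| = #|` E1|.
    apply: card_in_imfset => -[x y] [x' y'] /=.
    rewrite !in1 => /andP[/difE /= h _] /andP[/difE /= h' _] xx.
    move: h'; rewrite -h -xx => /addrI /oppr_inj [yy].
    by rewrite yy.
  apply/fsubset_leq_card/fsubsetP => x /imfsetP[e /=].
  by rewrite in1 => /andP[_ eS] ->.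
have c2 : (#|` E2| <= #|` S|)%N.
  have <- : #|` [fset e.2 | e in E2]| = #|` E2|.
    apply: card_in_imfset => -[x y] [x' y'] /=.
    rewrite !in2 => /andP[/difE /= h _] /andP[/difE /= h' _] yy.
    move: h'; rewrite -h -yy => /addIr [xx].
    by rewrite xx.
  apply/fsubset_leq_card/fsubsetP => x /imfsetP[e /=].
  by rewrite in2 => /andP[_ eS] ->.
rewrite (leq_trans (fsubset_leq_card sub)) // mul2n -addnn.
by rewrite (leq_trans _ (leq_add c1 c2)) // cardfsU leq_subr.
Qed.

Lemma leq_card_cut (p : nat) (B A : {fset nat}) (n d : int) :
  A `<=` B ->
  (forall e : nat * nat, e \in cut_edges p B n A -> e.1%:Z - e.2%:Z = d) ->
  (#|` Xp p B n| <= #|` Xp p A n| + #|` Xp p (B `\` A) n|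
                    + 2 * minn #|` A| #|` B `\` A|)%N.
Proof.
move=> AB difE.
have cutC : cut_edges p B n (B `\` A) = cut_edges p B n A.
  apply/fsetP => e; rewrite !in_cut_edges !in_fsetD; case: XpP => //= -[-> -> _].
  by rewrite !andbT (inj_eq negb_inj).
have cE : (#|` cut_edges p B n A| <= 2 * minn #|` A| #|` B `\` A|)%N.
  rewrite minnMr leq_min (leq_card_cut_edges _ _ _ _ _ difE) -cutC.
  by rewrite (leq_card_cut_edges _ _ _ _ d) // cutC.
have sub : Xp p B n `<=`
    (Xp p A n `|` Xp p (B `\` A) n) `|` cut_edges p B n A.
  apply/fsubsetP => e eX; rewrite 2!in_fsetU.
  have [e1 e2 ev] := XpP _ _ _ _ eX.
  case: (boolP (e.1 \in A)) => a1; case: (boolP (e.2 \in A)) => a2.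
  - by apply/orP; left; apply/orP; left; apply/XpP.
  - by apply/orP; right; rewrite in_cut_edges eX a1 (negbTE a2).
  - by apply/orP; right; rewrite in_cut_edges eX a2 (negbTE a1).
  - apply/orP; left; apply/orP; right; apply/XpP.
    by split; rewrite ?in_fsetD ?a1 ?a2.
apply: leq_trans (fsubset_leq_card sub) _.
rewrite cardfsU (leq_trans (leq_subr _ _)) //.
by rewrite leq_add // cardfsU leq_subr.
Qed.

(** * The recursion for N log N *)

Lemma ln2_gt0 (R : realType) : 0 < ln 2 :> R.
Proof. by rewrite ln_gt0 // ltr1n. Qed.

Lemma log2_ge0 (R : realType) (x : R) : 1 <= x -> 0 <= log2 x.
Proof. by move=> x1; rewrite divr_ge0 ?ln_ge0 // ler1n. Qed.

(** Merging two parts at least doubles the smaller one, so each element of the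
    smaller part sees its logarithm grow by at least [1]. *)
Lemma xlog2x_superadd (R : realType) (a b : R) : 0 < a -> a <= b ->
  a * log2 a + b * log2 b + a <= (a + b) * log2 (a + b).
Proof.
move=> a0 ab; have b0 : 0 < b by exact: lt_le_trans ab.
have la : log2 a + 1 <= log2 (a + b).
  have -> : log2 a + 1 = log2 (2 * a).
    by rewrite /log2 lnM ?posrE // mulrDl divff ?gt_eqF ?ln2_gt0 // addrC.
  by rewrite ler_pM2r ?invr_gt0 ?ln2_gt0 // ler_ln ?posrE; lra.
have lb : log2 b <= log2 (a + b).
  by rewrite ler_pM2r ?invr_gt0 ?ln2_gt0 // ler_ln ?posrE; lra.
rewrite mulrDl addrAC -[X in _ + X + _]mulr1 -mulrDr.
by rewrite lerD // ler_wpM2l // ltW.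
Qed.

(** * The edge bound *)

Lemma Xp_small (p : nat) (B : {fset nat}) (n : int) :
  (0 < p)%N -> n != 0 -> (#|` B| <= 1)%N -> Xp p B n = fset0.
Proof.
move=> p0 n0 cB; apply/eqP; rewrite -[_ == _]negbK; apply/negP => /fset0Pn[e].
move=> /XpP[e1 e2 [v ev]]; move: cB; rewrite leqNgt => /negP; apply.
have ne : e.1 != e.2.
  apply/eqP => ee; move: ev; rewrite ee subrr => /esym/eqP.
  by rewrite mulf_eq0 expf_eq0 (negbTE n0) eqz_nat (gtn_eqF p0) andbF.
have <- : #|` [fset e.1; e.2]| = 2%N by rewrite cardfs2 ne.
by apply/fsubset_leq_card/fsubsetP => x; rewrite !inE => /orP[]/eqP->.
Qed.

(** Both the constant [2] and the base [2] are those of the recursion: an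
    element of the smaller part costs at most two edges per cut, and it lies
    in the smaller part at most [log2 |B|] times. *)
Lemma card_Xp_le (R : realType) (p : nat) (B : {fset nat}) (n : int) :
  (1 < p)%N -> n != 0 ->
  (#|` Xp p B n|)%:R <= 2 * ((#|` B|)%:R * log2 (#|` B|)%:R) :> R.
Proof.
move=> p1 n0; have [N] := ubnP #|` B|; elim: N B => // N IH B.
rewrite ltnS => cBN; have [c1|c2] := leqP #|` B| 1.
  rewrite Xp_small ?(ltnW p1) // cardfs0 mulr_ge0 //.
  case: #|` B| => [|k]; first by rewrite mul0r.
  by rewrite mulr_ge0 ?ler0n // log2_ge0 // ler1n.
have [A [d [AB A0 C0 difE]]] := exists_uniform_cut p B n p1 n0 c2.
have cAC : #|` B| = (#|` A| + #|` B `\` A|)%N.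
  by rewrite -(cardfsID A B) (fsetIidPr AB).
have /IH hA : (#|` A| < N)%N.
  by apply: leq_trans cBN; rewrite cAC -[X in (X < _)%N]addn0 ltn_add2l.
have /IH hC : (#|` B `\` A| < N)%N.
  by apply: leq_trans cBN; rewrite cAC -[X in (X < _)%N]add0n ltn_add2r.
have := leq_card_cut p B A n d AB difE; rewrite -(ler_nat R) 2!natrD natrM.
rewrite cAC natrD => hX; apply: (le_trans hX).
set a := #|` A| in A0 hA *; set b := #|` _ `\` _| in C0 hC *.
have [ab|/ltnW ba] := leqP a b.
- have := xlog2x_superadd R a%:R b%:R; rewrite ltr0n ler_nat => /(_ A0 ab).
  by lra.
- have := xlog2x_superadd R b%:R a%:R; rewrite ltr0n ler_nat => /(_ C0 ba).
  by rewrite [b%:R + a%:R]addrC; lra.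
Qed.

Theorem theorem6p1 (R : realType) (B : {fset nat}) (p : nat) (n : int)
    (Bpos : forall b : nat, b \in B -> (0 < b)%N)
    (Bcard : (2 <= #|` B|)%N)
    (pprime : prime p) (n0 : n != 0) :
  (#|` Xp p B n|)%:R <= 1 + 4 * (#|` B|)%:R * log2 (#|` B|)%:R :> R.
Proof.
apply: le_trans (card_Xp_le R p B n (prime_gt1 pprime) n0) _.
have : 0 <= (#|` B|)%:R * log2 (#|` B|)%:R :> R.
  by rewrite mulr_ge0 ?ler0n // log2_ge0 // ler1n ltnW.
by rewrite -mulrA; lra.
Qed.
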